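(* Let $f(z)=e^z$ and let $W\subset\mathbb{C}$ be open and nonempty. Then there are infinitely many integers $n\geq 0$ such that $f^n(W)\cap(-\infty,0]\neq\emptyset$.
   Context: $f^n$ denotes the $n$-th iterate of $f$ ($f^0=\mathrm{id}$). *)

(* Defs.v *)
From Stdlib Require Import Reals.
Open Scope R_scope.

Definition Cplx : Type := (R * R)%type.
Definition Re (z : Cplx) : R := fst z.
Definition Im (z : Cplx) : R := snd z.

Definition cexp (z : Cplx) : Cplx := (exp (Re z) * cos (Im z), exp (Re z) * sin (Im z)).

Definition cdist (z w : Cplx) : R :=
  sqrt ((Re z - Re w) ^ 2 + (Im z - Im w) ^ 2).

Definition C_open (W : Cplx -> Prop) : Prop :=
  forall z, W z -> exists eps, eps > 0 /\ forall w, cdist w z < eps -> W w.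

Fixpoint iter_fun (n : nat) (f : Cplx -> Cplx) (z : Cplx) : Cplx :=
  match n with
  | O => z
  | S m => f (iter_fun m f z)
  end.

Definition in_neg_axis (z : Cplx) : Prop := Im z = 0 /\ Re z <= 0.

(* Main.v *)
(* Write [f = cexp], and let [d_n] be the modulus of the derivative of [f^n] at a
   point [z] of [W], which is the product of the [|f^k z|] for [1 <= k <= n].

   The sequence [d_n] is unbounded for every [z] (Misiurewicz).  Let
   [f^n z = x_n + i y_n].  Since [|y_(n+1)| = |f^(n+1) z| |sin y_n|] with
   [|sin y| <= |y|], the ratio [d_n / |y_n|] is nondecreasing, with a definite gain
   whenever [y_n] is far from [0].  If [d_n] were bounded, this would force [y_n] to
   be eventually small; but then [x_n], hence [d_n], tends to infinity.

   If [f^n(W)] missed the negative axis for all large [n], then on a disc of radius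
   [r] around [z] the imaginary part of [f^n] would miss the odd multiples of [PI],
   hence vary by at most [2 PI]; the first Fourier coefficient of [Im f^n] on the
   circle of radius [r] then bounds [d_n] by [8 PI / r]. *)
From Coquelicot Require Import Rcomplements Hierarchy Continuity Derive RInt RInt_analysis AutoDerive.
Require Import Defs.
From Stdlib Require Import Reals Lra Lia Classical.
Open Scope R_scope.

(** * Elementary bounds for sine and cosine *)

Lemma Rabs_sin_le (y : R) : Rabs (sin y) <= Rabs y.
Proof.
  assert (pos : forall u, 0 <= u -> Rabs (sin u) <= u).
  { intros u Hu. pose proof (SIN_bound u). apply Rabs_le. split.
    - destruct (Rle_lt_dec u 1) as [H1|H1]; [|lra].
      assert (0 <= sin u) by (apply sin_ge_0; [lra | pose proof PI2_1; lra]). lra.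
    - destruct (Req_dec u 0) as [->|]; [rewrite sin_0; lra|].
      left; apply sin_lt_x; lra. }
  destruct (Rle_lt_dec 0 y) as [Hy|Hy].
  - rewrite (Rabs_pos_eq y) by lra. auto.
  - rewrite <- Rabs_Ropp, <- sin_neg, (Rabs_left y) by lra. apply pos; lra.
Qed.

(** For [u >= e] the additive gap [Rabs (sin u) + (e - sin e) <= u] holds: by the mean value theorem
    while [sin u >= 0], and because [u > PI] once [sin u < 0]. Since [Rabs (sin u) <= 1], it implies
    the multiplicative form. *)
Lemma Rabs_sin_gap (e y : R) :
  0 < e <= 1 -> e <= Rabs y -> (1 + (e - sin e)) * Rabs (sin y) <= Rabs y.
Proof.
  intros He.
  assert (gap : 0 < e - sin e) by (pose proof (sin_lt_x e); lra).
  assert (0 < sin e) by (apply sin_gt_0; pose proof PI2_1; lra).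
  assert (pos : forall u, e <= u -> (1 + (e - sin e)) * Rabs (sin u) <= u).
  { intros u Hu. pose proof (SIN_bound u) as Hb.
    assert (Rabs (sin u) + (e - sin e) <= u).
    { destruct (Rle_lt_dec 0 (sin u)) as [Hs|Hs].
      - rewrite Rabs_pos_eq by lra.
        destruct (MVT_abs sin cos e u) as [c [Hc _]].
        { intros; apply derivable_pt_lim_sin. }
        pose proof (COS_bound c).
        assert (Rabs (cos c) <= 1) by (apply Rabs_le; lra).
        pose proof (Rle_abs (sin u - sin e)).
        rewrite (Rabs_pos_eq (u - e)) in Hc by lra. nra.
      - rewrite Rabs_left by lra.
        assert (PI < u).
        { apply Rnot_le_lt; intro. pose proof (sin_ge_0 u). lra. }
        pose proof PI2_3_2. lra. }
    assert (Rabs (sin u) <= 1) by (apply Rabs_le; lra). nra. }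
  intros Hy. destruct (Rle_lt_dec 0 y) as [Hy0|Hy0].
  - rewrite (Rabs_pos_eq y) in * by lra. auto.
  - rewrite (Rabs_left y) in * by lra.
    rewrite <- Rabs_Ropp, <- sin_neg. auto.
Qed.

Lemma cos_ge_quadratic (y : R) : 1 - y ^ 2 / 2 <= cos y.
Proof.
  replace (cos y) with (1 - 2 * sin (y / 2) * sin (y / 2))
    by (rewrite <- cos_2a_sin; f_equal; lra).
  pose proof (Rabs_sin_le (y / 2)) as H.
  apply Rsqr_le_abs_1 in H. unfold Rsqr in H. nra.
Qed.

(** * Unboundedness of the derivative along an orbit *)

Section Orbit.

(* [(x n, y n)] is an orbit of [cexp] and [d n] is proportional to the modulus
   of the derivative of the [n]-th iterate at its starting point. *)
Variables (x y d : nat -> R).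
Hypothesis x_step : forall n, x (S n) = exp (x n) * cos (y n).
Hypothesis y_step : forall n, y (S n) = exp (x n) * sin (y n).
Hypothesis d_step : forall n, d (S n) = exp (x n) * d n.
Hypothesis d_pos : 0 < d O.

Lemma deriv_pos (n : nat) : 0 < d n.
Proof.
  induction n as [|n IH]; [exact d_pos|].
  rewrite d_step. apply Rmult_lt_0_compat; [apply exp_pos | exact IH].
Qed.

(** The factor [exp (x n)] is common to [d (S n)] and [y (S n)] and cancels, so the ratio changes
    exactly by [|y n| / |sin (y n)|]. *)
Lemma deriv_over_im_step (n : nat) (q : R) :
  y (S n) <> 0 -> 1 <= q -> q * Rabs (sin (y n)) <= Rabs (y n) ->
  q * (d n / Rabs (y n)) <= d (S n) / Rabs (y (S n)).
Proof.
  intros Hy Hq Hs. pose proof (exp_pos (x n)) as He. pose proof (deriv_pos n) as Hd.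
  assert (Hsin : 0 < Rabs (sin (y n))).
  { apply Rabs_pos_lt. intro H0. apply Hy. rewrite y_step, H0. ring. }
  assert (Hyn : 0 < Rabs (y n)) by nra.
  rewrite d_step, y_step, Rabs_mult, (Rabs_pos_eq (exp _)) by lra.
  replace (exp (x n) * d n / (exp (x n) * Rabs (sin (y n))))
    with (d n / Rabs (y n) * (Rabs (y n) / Rabs (sin (y n)))) by (field; lra).
  rewrite Rmult_comm. apply Rmult_le_compat_l.
  - apply Rlt_le, Rdiv_lt_0_compat; lra.
  - apply Rle_div_r; lra.
Qed.

(* The ratio [d n / |y n|] is nondecreasing, and increases by a definite amount
   whenever [|y n| >= e]; at such times it is also at most [C / e]. *)
Lemma im_eventually_small (C e : R) :
  0 < e <= 1 -> (forall n, d n <= C) ->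
  exists m, forall n, (m <= n)%nat -> Rabs (y n) < e.
Proof.
  intros He HC.
  (* An orbit that reaches the real axis stays on it; otherwise all the ratios [d n / |y n|] are
     meaningful. *)
  destruct (classic (exists m, y m = 0)) as [[m Hm]|Hnz].
  { exists m. intros n Hn.
    replace (y n) with 0; [rewrite Rabs_R0; lra|].
    symmetry. induction Hn as [|n _ IH]; [exact Hm|].
    rewrite y_step, IH, sin_0. ring. }
  assert (nz : forall n, y n <> 0) by (intros n H; apply Hnz; now exists n).
  set (M n := d n / Rabs (y n)).
  apply NNPP. intro Hinf.
  assert (often : forall m, exists n, (m <= n)%nat /\ e <= Rabs (y n)).
  { intro m. apply NNPP. intro Hno. apply Hinf. exists m. intros n Hn.
    apply Rnot_le_lt. intro. apply Hno. now exists n. }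
  assert (mono1 : forall n, M n <= M (S n)).
  { intro n. rewrite <- (Rmult_1_l (M n)). apply deriv_over_im_step; auto; [lra|].
    rewrite Rmult_1_l. apply Rabs_sin_le. }
  assert (mono : forall n k, (n <= k)%nat -> M n <= M k).
  { intros n k Hk. induction Hk as [|k _ IH]; [lra|]. pose proof (mono1 k); lra. }
  assert (bounded : forall n, M n <= C / e).
  { intro n. destruct (often n) as [k [Hk Hyk]].
    apply Rle_trans with (M k); [now apply mono|]. unfold M.
    pose proof (deriv_pos k). pose proof (HC k).
    apply Rle_div_l; [lra|].
    assert (C / e * e = C) by (field; lra).
    assert (0 < C / e) by (apply Rdiv_lt_0_compat; lra). nra. }
  set (g := e - sin e).
  assert (Hg : 0 < g) by (unfold g; pose proof (sin_lt_x e); lra).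
  assert (M0 : 0 < M O).
  { apply Rdiv_lt_0_compat; [exact d_pos | apply Rabs_pos_lt, nz]. }
  (* Each visit to [|y| >= e] multiplies [M] by at least [1 + g]; linear growth in the number of
     visits already contradicts [bounded]. *)
  assert (grow : forall k, exists n, M O + INR k * (g * M O) <= M n).
  { induction k as [|k [n Hn]].
    - exists O. simpl. lra.
    - destruct (often n) as [j [Hj Hyj]]. exists (S j).
      pose proof (mono n j Hj). pose proof (mono O j ltac:(lia)).
      assert ((1 + g) * M j <= M (S j)).
      { apply deriv_over_im_step; auto; [lra | now apply Rabs_sin_gap]. }
      rewrite S_INR. nra. }
  assert (Hp : 0 < g * M O) by nra.
  destruct (INR_unbounded (C / e / (g * M O))) as [k Hk].
  apply Rlt_div_l in Hk; [|exact Hp].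
  destruct (grow k) as [n Hn]. pose proof (bounded n). lra.
Qed.

Lemma orbit_deriv_unbounded (C : R) : ~ (forall n, d n <= C).
Proof.
  intro HC.
  destruct (im_eventually_small C (1 / 2) ltac:(lra) HC) as [m Hm].
  assert (Hcos : forall n, (m <= n)%nat -> 7 / 8 <= cos (y n)).
  { intros n Hn. pose proof (cos_ge_quadratic (y n)).
    specialize (Hm n Hn). apply Rabs_lt_between in Hm. nra. }
  (* The index starts at [S m] because [x (S m)] is already nonnegative. With the factor [7 / 8]
     from the cosine, [exp u >= 1 + u] would fail to give [u + 1 / 2] for large [u], hence the
     quadratic bound on [exp u]. *)
  assert (Hx : forall k, INR k / 2 <= x (k + S m)%nat).
  { induction k as [|k IH].
    - simpl. rewrite x_step. pose proof (exp_pos (x m)).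
      pose proof (Hcos m ltac:(lia)). nra.
    - rewrite S_INR. simpl. rewrite x_step.
      pose proof (Hcos (k + S m)%nat ltac:(lia)) as Hc.
      set (u := x (k + S m)%nat) in *. pose proof (pos_INR k).
      assert (He : (1 + u / 2) * (1 + u / 2) <= exp u).
      { replace u with (u / 2 + u / 2) at 3 by lra. rewrite exp_plus.
        pose proof (exp_ineq1_le (u / 2)). nra. }
      nra. }
  (* From index [p] on, [x >= 1], so each step at least doubles [d]. *)
  set (p := (2 + S m)%nat).
  assert (Hd : forall k, d p * (1 + INR k) <= d (k + p)%nat).
  { induction k as [|k IH]; [simpl; lra|].
    rewrite S_INR. change (S k + p)%nat with (S (k + p)). rewrite d_step.
    pose proof (Hx (k + 2)%nat) as H. rewrite plus_INR in H. simpl (INR 2) in H.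
    replace (k + 2 + S m)%nat with (k + p)%nat in H by (unfold p; lia).
    pose proof (exp_ineq1_le (x (k + p)%nat)). pose proof (pos_INR k).
    pose proof (deriv_pos p). pose proof (deriv_pos (k + p)). nra. }
  pose proof (deriv_pos p) as Hp.
  destruct (INR_unbounded (C / d p)) as [k Hk].
  apply Rlt_div_l in Hk; [|exact Hp].
  pose proof (Hd k). pose proof (HC (k + p)%nat). nra.
Qed.

End Orbit.

(** * Tools for integrals over a period and with a parameter *)

Lemma continuity_2d_pt_section (f : R -> R -> R) (x y : R) :
  continuity_2d_pt f x y -> continuous (f x) y.
Proof.
  intros Hf. apply continuity_pt_filterlim. apply continuity_pt_locally. intro eps.
  destruct (Hf eps) as [delta Hd]. exists delta. intros v Hv.
  apply Hd; [|exact Hv]. rewrite Rminus_diag, Rabs_R0. apply cond_pos.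
Qed.

(** Periodicity cancels the boundary terms. *)
Lemma RInt_by_parts_periodic (F F' w w' : R -> R) (T : R) :
  (forall t, is_derive F t (F' t)) -> (forall t, is_derive w t (w' t)) ->
  (forall t, continuous F' t) -> (forall t, continuous w' t) ->
  F T = F 0 -> w T = w 0 ->
  RInt (fun t => F' t * w t) 0 T = - RInt (fun t => F t * w' t) 0 T.
Proof.
  intros HF Hw CF' Cw' PF Pw.
  assert (CF : forall t, continuous F t).
  { intro t. apply (@ex_derive_continuous R_AbsRing R_NormedModule). now exists (F' t). }
  assert (Cw : forall t, continuous w t).
  { intro t. apply (@ex_derive_continuous R_AbsRing R_NormedModule). now exists (w' t). }
  assert (I1 : ex_RInt (fun t => F' t * w t) 0 T).
  { apply (ex_RInt_continuous (V := R_CompleteNormedModule)). intros t _.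
    now apply (continuous_mult (K := R_AbsRing) F' w). }
  assert (I2 : ex_RInt (fun t => F t * w' t) 0 T).
  { apply (ex_RInt_continuous (V := R_CompleteNormedModule)). intros t _.
    now apply (continuous_mult (K := R_AbsRing) F w'). }
  assert (I : is_RInt (fun t => F' t * w t + F t * w' t) 0 T (F T * w T - F 0 * w 0)).
  { apply (is_RInt_derive (fun t => F t * w t)); intros t _.
    - now apply is_derive_mult.
    - apply (continuous_plus (V := R_NormedModule) (fun t => F' t * w t) (fun t => F t * w' t)).
      + now apply (continuous_mult (K := R_AbsRing) F' w).
      + now apply (continuous_mult (K := R_AbsRing) F w'). }
  apply (is_RInt_unique (V := R_CompleteNormedModule)) in I.
  assert (S : RInt (fun t => F' t * w t + F t * w' t) 0 T
    = RInt (fun t => F' t * w t) 0 T + RInt (fun t => F t * w' t) 0 T)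
    by exact (RInt_plus (V := R_CompleteNormedModule) _ _ _ _ I1 I2).
  rewrite PF, Pw in I. lra.
Qed.

(** Differentiation under the integral sign, for the Fourier moments of a function on circles of
    varying radius [s]. *)
Lemma is_derive_moment (F G : R -> R -> R) (w : R -> R) (T s : R) :
  (forall s t, is_derive (fun s => F s t) s (G s t)) ->
  (forall s t, continuity_2d_pt G s t) ->
  (forall s t, continuous (F s) t) ->
  (forall t, continuous w t) ->
  is_derive (fun s => RInt (fun t => F s t * w t) 0 T) s
    (RInt (fun t => G s t * w t) 0 T).
Proof.
  intros HF HG CF Cw.
  assert (D : forall t s, is_derive (fun s => F s t * w t) s (G s t * w t)).
  { intros t u. replace (G u t * w t) with (G u t * w t + F u t * 0) by ring.
    apply (is_derive_mult (fun u => F u t) (fun _ => w t)); [apply HF | exact (is_derive_const (w t) u)]. }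
  replace (RInt (fun t => G s t * w t) 0 T)
    with (RInt (fun t => Derive (fun u => F u t * w t) s) 0 T).
  2:{ apply RInt_ext. intros t _. apply is_derive_unique, D. }
  apply is_derive_RInt_param.
  - apply filter_forall. intros u t _. eexists; apply D.
  - intros t _.
    apply continuity_2d_pt_ext with (fun u v => G u v * w v).
    + intros u v. symmetry. apply is_derive_unique, D.
    + apply continuity_2d_pt_mult; [apply HG|].
      apply (continuity_1d_2d_pt_comp w (fun _ v => v)); [|apply continuity_2d_pt_id2].
      apply continuity_pt_filterlim, Cw.
  - apply filter_forall. intros u.
    apply (ex_RInt_continuous (V := R_CompleteNormedModule)). intros t _.
    now apply (continuous_mult (K := R_AbsRing) (F u) w).
Qed.

Lemma RInt_ext_R (f g : R -> R) (l r : R) :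
  (forall t, f t = g t) -> RInt f l r = RInt g l r.
Proof. intro H. apply RInt_ext. intros t _. apply H. Qed.

Lemma RInt_scal_R (f : R -> R) (c l r : R) :
  (forall t, continuous f t) -> RInt (fun t => c * f t) l r = c * RInt f l r.
Proof.
  intro Hf. apply (RInt_scal (V := R_CompleteNormedModule) f).
  apply (ex_RInt_continuous (V := R_CompleteNormedModule)). auto.
Qed.

(** * Bounding a derivative by the oscillation of the imaginary part on a circle *)

Section GradientEstimate.

(* [U] and [V] are the real and imaginary parts of a holomorphic function [g] in
   polar coordinates around a point where [g' = a + i b]; [A] and [B] are their
   radial derivatives, and the angular ones are given by Cauchy-Riemann. *)
Variables (U V A B : R -> R -> R) (a b : R).
Hypothesis U_ds : forall s t, is_derive (fun s => U s t) s (A s t).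
Hypothesis V_ds : forall s t, is_derive (fun s => V s t) s (B s t).
Hypothesis U_dt : forall s t, is_derive (U s) t (- (s * B s t)).
Hypothesis V_dt : forall s t, is_derive (V s) t (s * A s t).
Hypothesis A_cont : forall s t, continuity_2d_pt A s t.
Hypothesis B_cont : forall s t, continuity_2d_pt B s t.
Hypothesis U_per : forall s, U s (2 * PI) = U s 0.
Hypothesis V_per : forall s, V s (2 * PI) = V s 0.
Hypothesis B_center : forall t, B 0 t = a * sin t + b * cos t.

(** The imaginary part of [(a + i b) e^(it)], with [w'] its real part. This Fourier mode is matched
    to [B 0], so that the moment [Phi] has derivative at [0] equal to the integral of [w ^ 2]. *)
Let w (t : R) : R := a * sin t + b * cos t.
Let w' (t : R) : R := a * cos t - b * sin t.

Let w_derive t : is_derive w t (w' t).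
Proof. unfold w, w'. auto_derive; [easy | ring]. Qed.

Let w'_derive t : is_derive w' t (- w t).
Proof. unfold w, w'. auto_derive; [easy | ring]. Qed.

Let w_cont t : continuous w t.
Proof. apply (@ex_derive_continuous R_AbsRing R_NormedModule). eexists; apply w_derive. Qed.

Let w'_cont t : continuous w' t.
Proof. apply (@ex_derive_continuous R_AbsRing R_NormedModule). eexists; apply w'_derive. Qed.

Let w_per : w (2 * PI) = w 0.
Proof. unfold w. now rewrite sin_2PI, cos_2PI, sin_0, cos_0. Qed.

Let w'_per : w' (2 * PI) = w' 0.
Proof. unfold w'. now rewrite sin_2PI, cos_2PI, sin_0, cos_0. Qed.

Let U_cont s t : continuous (U s) t.
Proof. apply (@ex_derive_continuous R_AbsRing R_NormedModule). eexists; apply U_dt. Qed.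

Let V_cont s t : continuous (V s) t.
Proof. apply (@ex_derive_continuous R_AbsRing R_NormedModule). eexists; apply V_dt. Qed.

Let Phi (s : R) : R := RInt (fun t => V s t * w t) 0 (2 * PI).
Let Psi (s : R) : R := RInt (fun t => U s t * w' t) 0 (2 * PI).
Let dPhi (s : R) : R := RInt (fun t => B s t * w t) 0 (2 * PI).
Let dPsi (s : R) : R := RInt (fun t => A s t * w' t) 0 (2 * PI).

Let Phi_derive s : is_derive Phi s (dPhi s).
Proof. now apply is_derive_moment. Qed.

Let Psi_derive s : is_derive Psi s (dPsi s).
Proof. now apply is_derive_moment. Qed.

(** By Cauchy-Riemann [- (s * B s t)] is the angular derivative of [U]; integration by parts moves
    it onto [w]. *)
Let radial_Phi s : s * dPhi s = Psi s.
Proof.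
  assert (H : RInt (fun t => - (s * B s t) * w t) 0 (2 * PI) = - Psi s).
  { apply RInt_by_parts_periodic; auto. intro t.
    apply (continuous_opp (V := R_NormedModule)).
    apply (continuous_scal_r (K := R_AbsRing) (V := R_NormedModule) s (B s)).
    now apply continuity_2d_pt_section. }
  rewrite (RInt_ext_R _ (fun t => - s * (B s t * w t))), RInt_scal_R in H.
  - fold (dPhi s) in H. lra.
  - intro t. apply (continuous_mult (K := R_AbsRing) (B s) w); [|auto].
    now apply continuity_2d_pt_section.
  - intros; ring.
Qed.

(** The same argument with [s * A s t], the angular derivative of [V], and [w'' = - w]. *)
Let radial_Psi s : s * dPsi s = Phi s.
Proof.
  assert (H : RInt (fun t => s * A s t * w' t) 0 (2 * PI)
    = - RInt (fun t => V s t * - w t) 0 (2 * PI)).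
  { apply RInt_by_parts_periodic; auto; intro t.
    - apply (continuous_scal_r (K := R_AbsRing) (V := R_NormedModule) s (A s)).
      now apply continuity_2d_pt_section.
    - now apply (continuous_opp (V := R_NormedModule)). }
  rewrite (RInt_ext_R _ (fun t => s * (A s t * w' t))), RInt_scal_R in H.
  - rewrite (RInt_ext_R (fun t => V s t * - w t) (fun t => - 1 * (V s t * w t))),
      RInt_scal_R in H.
    + fold (dPsi s) (Phi s) in H. lra.
    + intro t. now apply (continuous_mult (K := R_AbsRing) (V s) w).
    + intros; ring.
  - intro t. apply (continuous_mult (K := R_AbsRing) (A s) w'); [|auto].
    now apply continuity_2d_pt_section.
  - intros; ring.
Qed.

(** The two radial equations make the derivative of [s * (Phi s - Psi s)] vanish, and this function
    is [0] at [0]. *)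
Let Phi_eq_Psi s : 0 < s -> Phi s = Psi s.
Proof.
  intro Hs.
  assert (H : 0 * (Phi 0 - Psi 0) = s * (Phi s - Psi s)).
  { apply (eq_is_derive (V := R_NormedModule) (fun s => s * (Phi s - Psi s))); [|exact Hs].
    intros u _. evar_last.
    - apply is_derive_mult; [apply is_derive_id|].
      apply (is_derive_minus (V := R_NormedModule)); [apply Phi_derive | apply Psi_derive].
    - unfold zero, one, minus, plus, opp; simpl.
      pose proof (radial_Phi u). pose proof (radial_Psi u). lra. }
  nra.
Qed.

Let dPhi_center : dPhi 0 = PI * (a ^ 2 + b ^ 2).
Proof.
  unfold dPhi.
  rewrite (RInt_ext_R _ (fun t => w t * w t)) by (intros t; rewrite B_center; reflexivity).
  apply (is_RInt_unique (V := R_CompleteNormedModule)).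
  evar_last.
  - apply (is_RInt_derive (fun t => a ^ 2 * ((t - sin t * cos t) / 2)
      + b ^ 2 * ((t + sin t * cos t) / 2) + a * b * (sin t * sin t))).
    + intros t _. auto_derive; [easy|]. unfold w.
      pose proof (sin2_cos2 t) as E. unfold Rsqr in E.
      rewrite !Rmult_1_l, !Rmult_1_r.
      replace 1 with (sin t * sin t + cos t * cos t) by lra. field.
    + intros t _. now apply (continuous_mult (K := R_AbsRing) w w).
  - unfold minus, plus, opp; simpl. rewrite sin_2PI, sin_0. field.
Qed.

(* [Phi s / s] is constant on [s > 0], with limit [Phi' 0] at [0]. *)
Let Phi_linear r : 0 < r -> Phi r = PI * (a ^ 2 + b ^ 2) * r.
Proof.
  intro Hr.
  assert (P0 : Phi 0 = 0) by (pose proof (radial_Psi 0); lra).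
  assert (const : forall s, 0 < s < r -> Phi s / s = Phi r / r).
  { intros s Hs. apply (eq_is_derive (V := R_NormedModule) (fun s => Phi s / s)); [|lra].
    intros u Hu. evar_last.
    - apply is_derive_div; [apply Phi_derive | apply is_derive_id | lra].
    - unfold zero, one; simpl.
      pose proof (radial_Phi u). pose proof (Phi_eq_Psi u ltac:(lra)).
      replace (dPhi u * u - Phi u * 1) with 0 by lra. unfold Rdiv; ring. }
  assert (lim : Phi r / r = dPhi 0).
  { apply cond_eq. intros eps Heps.
    pose proof (Phi_derive 0) as D. apply is_derive_Reals in D.
    destruct (D eps Heps) as [delta Hd].
    pose proof (cond_pos delta) as Hdelta.
    set (h := Rmin (delta / 2) (r / 2)).
    assert (0 < h) by (apply Rmin_pos; lra).
    assert (h <= delta / 2) by apply Rmin_l.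
    assert (h <= r / 2) by apply Rmin_r.
    specialize (Hd h ltac:(lra)). rewrite Rabs_pos_eq in Hd by lra.
    specialize (Hd ltac:(lra)). rewrite Rplus_0_l, P0, Rminus_0_r, const in Hd by lra.
    exact Hd. }
  rewrite dPhi_center in lim. rewrite <- lim. field. lra.
Qed.

(** As [w] has mean zero, [V] may be replaced by [V - c] in [Phi r]. This bounds [Phi r] by
    [2 * PI * M * (|a| + |b|)], to be compared with its exact value from [Phi_linear]. *)
Lemma gradient_estimate (r c M : R) :
  0 < r -> (forall t, Rabs (V r t - c) <= M) ->
  r * (a ^ 2 + b ^ 2) <= 2 * M * (Rabs a + Rabs b).
Proof.
  intros Hr HM.
  assert (Iw : RInt w 0 (2 * PI) = 0).
  { apply (is_RInt_unique (V := R_CompleteNormedModule)). evar_last.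
    - apply (is_RInt_derive (fun t => - w' t)); intros t _; [|apply w_cont].
      evar_last; [apply (is_derive_opp (V := R_NormedModule)), w'_derive|].
      unfold opp; simpl. ring.
    - unfold minus, plus, opp; simpl. rewrite w'_per. ring. }
  assert (Cw : forall t, continuous (fun t => (V r t - c) * w t) t).
  { intro t. apply (continuous_mult (K := R_AbsRing) (fun t => V r t - c) w); [|auto].
    apply (continuous_minus (V := R_NormedModule) (V r) (fun _ => c)); [auto|].
    apply continuous_const. }
  assert (E : RInt (fun t => (V r t - c) * w t) 0 (2 * PI) = Phi r :> R).
  { rewrite (RInt_ext_R _ (fun t => V r t * w t - c * w t)) by (intros; ring).
    transitivity (Phi r - RInt (fun t => c * w t) 0 (2 * PI)).
    - apply (RInt_minus (V := R_CompleteNormedModule) (fun t => V r t * w t) (fun t => c * w t)).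
      + apply (ex_RInt_continuous (V := R_CompleteNormedModule)). intros t _.
        now apply (continuous_mult (K := R_AbsRing) (V r) w).
      + apply (ex_RInt_continuous (V := R_CompleteNormedModule)). intros t _.
        now apply (continuous_scal_r (K := R_AbsRing) (V := R_NormedModule) c w).
    - rewrite RInt_scal_R, Iw by auto. rewrite Rmult_0_r. apply Rminus_0_r. }
  pose proof PI_RGT_0 as HPI.
  assert (bound : Rabs (Phi r) <= (2 * PI - 0) * (M * (Rabs a + Rabs b))).
  { rewrite <- E. apply abs_RInt_le_const; [lra| |].
    - apply (ex_RInt_continuous (V := R_CompleteNormedModule)). auto.
    - intros t _. rewrite Rabs_mult.
      apply Rmult_le_compat; [apply Rabs_pos | apply Rabs_pos | apply HM |].
      unfold w. eapply Rle_trans; [apply Rabs_triang|]. rewrite !Rabs_mult.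
      assert (Rabs (sin t) <= 1) by (apply Rabs_le, SIN_bound).
      assert (Rabs (cos t) <= 1) by (apply Rabs_le, COS_bound).
      pose proof (Rabs_pos a). pose proof (Rabs_pos b). nra. }
  pose proof (Rle_abs (Phi r)). rewrite (Phi_linear r Hr) in *. nra.
Qed.

End GradientEstimate.

(** * Iterates of the exponential in polar coordinates *)

Lemma is_derive_exp_cos (X Y : R -> R) (u dx dy : R) :
  is_derive X u dx -> is_derive Y u dy ->
  is_derive (fun u => exp (X u) * cos (Y u)) u
    (exp (X u) * (cos (Y u) * dx - sin (Y u) * dy)).
Proof.
  intros HX HY. auto_derive.
  - split; [now exists dx | split; [now exists dy | easy]].
  - replace (Derive (fun x => X x) u) with dx by (symmetry; now apply is_derive_unique).
    replace (Derive (fun x => Y x) u) with dy by (symmetry; now apply is_derive_unique).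
    ring.
Qed.

Lemma is_derive_exp_sin (X Y : R -> R) (u dx dy : R) :
  is_derive X u dx -> is_derive Y u dy ->
  is_derive (fun u => exp (X u) * sin (Y u)) u
    (exp (X u) * (sin (Y u) * dx + cos (Y u) * dy)).
Proof.
  intros HX HY. auto_derive.
  - split; [now exists dx | split; [now exists dy | easy]].
  - replace (Derive (fun x => X x) u) with dx by (symmetry; now apply is_derive_unique).
    replace (Derive (fun x => Y x) u) with dy by (symmetry; now apply is_derive_unique).
    ring.
Qed.

Definition polar (z : Cplx) (s t : R) : Cplx := (Re z + s * cos t, Im z + s * sin t).

Definition polar_iter (n : nat) (z : Cplx) (s t : R) : Cplx :=
  iter_fun n cexp (polar z s t).

(** By the chain rule this is [e^(it)] times the complex derivative of the [n]-th iterate at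
    [polar z s t]. *)
Fixpoint radial_deriv (n : nat) (z : Cplx) (s t : R) : Cplx :=
  match n with
  | O => (cos t, sin t)
  | S m =>
      let p := polar_iter m z s t in
      let q := radial_deriv m z s t in
      (exp (Re p) * (cos (Im p) * Re q - sin (Im p) * Im q),
       exp (Re p) * (sin (Im p) * Re q + cos (Im p) * Im q))
  end.

Lemma polar_iter_radial (n : nat) (z : Cplx) (s t : R) :
  is_derive (fun s => Re (polar_iter n z s t)) s (Re (radial_deriv n z s t)) /\
  is_derive (fun s => Im (polar_iter n z s t)) s (Im (radial_deriv n z s t)).
Proof.
  induction n as [|n [IHx IHy]].
  - simpl. split; auto_derive; trivial; ring.
  - split.
    + exact (is_derive_exp_cos _ _ s _ _ IHx IHy).
    + exact (is_derive_exp_sin _ _ s _ _ IHx IHy).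
Qed.

(** Cauchy-Riemann in polar form: the angular derivative is [i s] times the radial one, a relation
    preserved by the chain rule. *)
Lemma polar_iter_angular (n : nat) (z : Cplx) (s t : R) :
  is_derive (fun t => Re (polar_iter n z s t)) t (- (s * Im (radial_deriv n z s t))) /\
  is_derive (fun t => Im (polar_iter n z s t)) t (s * Re (radial_deriv n z s t)).
Proof.
  induction n as [|n [IHx IHy]].
  - simpl. split; auto_derive; trivial; ring.
  - split.
    + evar_last; [exact (is_derive_exp_cos _ _ t _ _ IHx IHy)|]. simpl. ring.
    + evar_last; [exact (is_derive_exp_sin _ _ t _ _ IHx IHy)|]. simpl. ring.
Qed.

Lemma continuity_2d_pt_comp1 (f : R -> R) (g : R -> R -> R) (s t : R) :
  continuity f -> continuity_2d_pt g s t ->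
  continuity_2d_pt (fun s t => f (g s t)) s t.
Proof. intros Hf. apply continuity_1d_2d_pt_comp, Hf. Qed.

Lemma continuity_exp : continuity exp.
Proof. apply derivable_continuous, derivable_exp. Qed.

Ltac solve_continuity_2d :=
  repeat first
    [ assumption
    | apply continuity_2d_pt_id1 | apply continuity_2d_pt_id2 | apply continuity_2d_pt_const
    | apply continuity_2d_pt_plus | apply continuity_2d_pt_opp | apply continuity_2d_pt_mult
    | apply (continuity_2d_pt_comp1 exp _ _ _ continuity_exp)
    | apply (continuity_2d_pt_comp1 cos _ _ _ continuity_cos)
    | apply (continuity_2d_pt_comp1 sin _ _ _ continuity_sin) ].

Lemma polar_iter_continuous (n : nat) (z : Cplx) (s t : R) :
  continuity_2d_pt (fun s t => Re (polar_iter n z s t)) s t /\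
  continuity_2d_pt (fun s t => Im (polar_iter n z s t)) s t.
Proof.
  induction n as [|n [IHx IHy]]; simpl; split; solve_continuity_2d.
Qed.

Lemma radial_deriv_continuous (n : nat) (z : Cplx) (s t : R) :
  continuity_2d_pt (fun s t => Re (radial_deriv n z s t)) s t /\
  continuity_2d_pt (fun s t => Im (radial_deriv n z s t)) s t.
Proof.
  induction n as [|n [IHx IHy]]; simpl.
  - split; solve_continuity_2d.
  - destruct (polar_iter_continuous n z s t). split; solve_continuity_2d.
Qed.

Lemma polar_iter_center (n : nat) (z : Cplx) (t : R) :
  polar_iter n z 0 t = iter_fun n cexp z.
Proof.
  unfold polar_iter, polar. rewrite !Rmult_0_l, !Rplus_0_r. now destruct z.
Qed.

Lemma polar_iter_periodic (n : nat) (z : Cplx) (s : R) :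
  polar_iter n z s (2 * PI) = polar_iter n z s 0.
Proof. unfold polar_iter, polar. now rewrite cos_2PI, sin_2PI, cos_0, sin_0. Qed.

(** At the center only the factor [e^(it)] depends on [t]; this supplies the hypothesis
    [B_center]. *)
Lemma radial_deriv_center (n : nat) (z : Cplx) (t : R) :
  Re (radial_deriv n z 0 t)
    = Re (radial_deriv n z 0 0) * cos t - Im (radial_deriv n z 0 0) * sin t /\
  Im (radial_deriv n z 0 t)
    = Re (radial_deriv n z 0 0) * sin t + Im (radial_deriv n z 0 0) * cos t.
Proof.
  induction n as [|n [IHx IHy]]; simpl.
  - rewrite cos_0, sin_0. split; ring.
  - rewrite !polar_iter_center, IHx, IHy. split; ring.
Qed.

(** The modulus of the derivative of the [n]-th iterate, as [|e^w| = exp (Re w)]. *)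
Fixpoint abs_deriv (n : nat) (z : Cplx) : R :=
  match n with
  | O => 1
  | S m => exp (Re (iter_fun m cexp z)) * abs_deriv m z
  end.

Lemma abs_deriv_pos (n : nat) (z : Cplx) : 0 < abs_deriv n z.
Proof.
  induction n as [|n IH]; simpl; [lra|].
  apply Rmult_lt_0_compat; [apply exp_pos | exact IH].
Qed.

Lemma abs_deriv_sqr (n : nat) (z : Cplx) :
  abs_deriv n z ^ 2 = Re (radial_deriv n z 0 0) ^ 2 + Im (radial_deriv n z 0 0) ^ 2.
Proof.
  induction n as [|n IH].
  - simpl. rewrite cos_0, sin_0. ring.
  - cbn [abs_deriv radial_deriv]. cbv zeta. rewrite polar_iter_center.
    rewrite Rpow_mult_distr, IH. cbn [Re Im fst snd].
    set (y := Im (iter_fun n cexp z)).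
    pose proof (sin2_cos2 y) as E. unfold Rsqr in E.
    set (p := Re (radial_deriv n z 0 0)). set (q := Im (radial_deriv n z 0 0)).
    transitivity (exp (Re (iter_fun n cexp z)) ^ 2 * (p ^ 2 + q ^ 2)
      * (sin y * sin y + cos y * cos y)); [rewrite E|]; ring.
Qed.

Lemma abs_deriv_bound (n : nat) (z : Cplx) (r c M : R) :
  0 < r -> (forall t, Rabs (Im (polar_iter n z r t) - c) <= M) ->
  abs_deriv n z <= 4 * M / r.
Proof.
  intros Hr HM.
  set (a := Re (radial_deriv n z 0 0)). set (b := Im (radial_deriv n z 0 0)).
  assert (H : r * (a ^ 2 + b ^ 2) <= 2 * M * (Rabs a + Rabs b)).
  { apply (gradient_estimate (fun s t => Re (polar_iter n z s t))
      (fun s t => Im (polar_iter n z s t)) (fun s t => Re (radial_deriv n z s t))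
      (fun s t => Im (radial_deriv n z s t))) with (c := c); auto.
    - intros; apply polar_iter_radial.
    - intros; apply polar_iter_radial.
    - intros s t; exact (proj1 (polar_iter_angular n z s t)).
    - intros s t; exact (proj2 (polar_iter_angular n z s t)).
    - intros; apply radial_deriv_continuous.
    - intros; apply radial_deriv_continuous.
    - intros; now rewrite polar_iter_periodic.
    - intros; now rewrite polar_iter_periodic.
    - intros t; exact (proj2 (radial_deriv_center n z t)). }
  pose proof (abs_deriv_sqr n z) as E. fold a b in E.
  pose proof (abs_deriv_pos n z) as Hd. set (d := abs_deriv n z) in *.
  assert (Ha : Rabs a <= d) by (apply Rabs_le; nra).
  assert (Hb : Rabs b <= d) by (apply Rabs_le; nra).
  assert (HM0 : 0 <= M) by (eapply Rle_trans; [apply Rabs_pos | apply (HM 0)]).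
  rewrite <- E in H. apply Rle_div_r; [exact Hr|].
  (* Both [|a|] and [|b|] are at most [d], so the estimate reads [r * d ^ 2 <= 4 * M * d], and
     [d > 0] cancels. *)
  assert (d * r * d <= 4 * M * d) by nra. nra.
Qed.

(** * Meeting the negative axis, and the conclusion *)

Lemma odd_multiple_PI_above (c : R) :
  exists y, c <= y <= c + 2 * PI /\ cos y = -1 /\ sin y = 0.
Proof.
  pose proof PI_RGT_0 as HPI.
  destruct (archimed ((c / PI - 1) / 2)) as [H1 H2].
  set (k := up ((c / PI - 1) / 2)) in *.
  assert (E : cos (IZR k * PI + PI / 2) = 0) by (apply cos_eq_0_1; now exists k).
  (* The witness is [(2 k + 1) PI]; writing it as a double angle reduces its cosine and sine to the
     vanishing of [cos (k PI + PI / 2)]. *)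
  exists (2 * (IZR k * PI + PI / 2)). rewrite cos_2a_cos, sin_2a, E.
  repeat split; try ring.
  - assert (c / PI * PI = c) by (field; lra). nra.
  - assert (c / PI * PI = c) by (field; lra). nra.
Qed.

(* An interval of length [2 PI] contains an odd multiple of [PI], and [cexp] maps
   the corresponding horizontal line to the negative axis. *)
Lemma im_variation_bound (n : nat) (z : Cplx) (r t : R) :
  (forall s, 0 <= s <= r -> ~ in_neg_axis (polar_iter (S n) z s t)) ->
  0 <= r ->
  Rabs (Im (polar_iter n z r t) - Im (iter_fun n cexp z)) <= 2 * PI.
Proof.
  intros Havoid Hr. rewrite <- (polar_iter_center n z t).
  set (V s := Im (polar_iter n z s t)). change (Rabs (V r - V 0) <= 2 * PI).
  assert (Vc : continuity V).
  { intro s. apply derivable_continuous_pt.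
    eexists. apply is_derive_Reals, (proj2 (polar_iter_radial n z s t)). }
  (* By the intermediate value theorem on the ray, such a [y] would be the imaginary part of some
     [polar_iter n z s t], whose image under [cexp] is the negative real [- exp (Re _)]. *)
  assert (miss : forall y, Rmin (V 0) (V r) <= y <= Rmax (V 0) (V r) ->
    cos y = -1 -> sin y = 0 -> False).
  { intros y Hy Hcos Hsin.
    destruct (IVT_gen V 0 r y Vc Hy) as [s [Hs HV]].
    rewrite Rmin_left, Rmax_right in Hs by lra.
    apply (Havoid s Hs). unfold V in HV.
    change (polar_iter (S n) z s t) with (cexp (polar_iter n z s t)).
    unfold cexp, in_neg_axis. rewrite HV, Hcos, Hsin. simpl.
    pose proof (exp_pos (Re (polar_iter n z s t))). split; lra. }
  apply Rnot_lt_le. intro Hlt. destruct (Rle_lt_dec (V 0) (V r)) as [H|H].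
  - rewrite Rabs_pos_eq in Hlt by lra.
    destruct (odd_multiple_PI_above (V 0)) as [y [Hy [Hc Hs]]].
    apply (miss y); auto. rewrite Rmin_left, Rmax_right; lra.
  - rewrite Rabs_left in Hlt by lra.
    destruct (odd_multiple_PI_above (V r)) as [y [Hy [Hc Hs]]].
    apply (miss y); auto. rewrite Rmin_right, Rmax_left; lra.
Qed.

(* Infinitely many n >= 0 : for every N there is n >= N with f^n(W) meeting (-inf,0]. *)
Theorem mainTheorem5 (W : Cplx -> Prop) (HW : C_open W) (Hne : exists z, W z) :
  forall N : nat, exists n : nat, (N <= n)%nat /\
    exists w : Cplx, W w /\ in_neg_axis (iter_fun n cexp w).
Proof.
  intro N. apply NNPP. intro Hno.
  destruct Hne as [z Hz]. destruct (HW z Hz) as [eps [Heps Hball]].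
  set (r := eps / 2).
  assert (disc : forall s t, 0 <= s <= r -> W (polar z s t)).
  { intros s t Hs. apply Hball.
    replace (cdist (polar z s t) z) with s; [unfold r in Hs; lra|].
    unfold cdist, polar; simpl. symmetry. apply sqrt_lem_1; [nra | lra |].
    pose proof (sin2_cos2 t) as E. unfold Rsqr in E. nra. }
  assert (bound : forall n, (N <= n)%nat -> abs_deriv n z <= 4 * (2 * PI) / r).
  { intros n Hn. apply abs_deriv_bound with (c := Im (iter_fun n cexp z));
      [unfold r; lra|].
    intro t. apply im_variation_bound; [|unfold r; lra].
    (* Bounding the variation of the [n]-th iterate uses avoidance at time [S n], which is still at
       least [N]. *)
    intros s Hs Hneg. apply Hno. exists (S n). split; [lia|].
    exists (polar z s t). split; [now apply disc | exact Hneg]. }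
  (* The orbit is started at time [N], where the bound begins to hold; its [d 0] is [abs_deriv N z],
     which is only known to be positive. *)
  apply (orbit_deriv_unbounded (fun n => Re (iter_fun (n + N) cexp z))
    (fun n => Im (iter_fun (n + N) cexp z)) (fun n => abs_deriv (n + N) z))
    with (C := 4 * (2 * PI) / r); try reflexivity.
  - apply abs_deriv_pos.
  - intro n. apply bound. lia.
Qed.
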